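(* Let $\mathscr A$ be a $C^*$-algebra and $\mathscr E$ a Hilbert $\mathscr A$-module. Let $\mathscr H$ and $\mathscr K$ be closed submodules of $\mathscr E$ such that $\mathscr H\cap\mathscr K$ is an orthogonally complemented submodule of $\mathscr E$. Let $\omega_j$ be a positive linear functional on $\mathscr A$ for each $j\geq 1$. If $(\mathscr H\cap\mathscr K)_{\omega_j}=\mathscr H_{\omega_j}\cap\mathscr K_{\omega_j}$ for each $j\ge 1$, then $$(\mathscr H\cap\mathscr K)_\omega=\mathscr H_\omega\cap\mathscr K_\omega\qquad\text{for all }\omega\in\sigma\text{-}\mathrm{co}\{\omega_1,\omega_2,\ldots\}.$$
   Context: For a positive linear functional $\omega$ on $\mathscr A$, put $\mathscr N_\omega=\{x\in\mathscr E:\omega(\langle x,x\rangle)=0\}$, a closed subspace of $\mathscr E$. The quotient $\mathscr E/\mathscr N_\omega$ carries the inner product $(x+\mathscr N_\omega,y+\mathscr N_\omega)_\omega:=\omega(\langle x,y\rangle)$; $\mathscr E_\omega$ denotes its Hilbert space completion, and $\iota_\omega:\mathscr E\to\mathscr E_\omega$ is the map $\iota_\omega(x)=x+\mathscr N_\omega$. For a closed submodule $\mathscr L$ of $\mathscr E$, the localization $\mathscr L_\omega$ is identified with the closed subspace $\overline{\iota_\omega(\mathscr L)}$ (norm closure) of $\mathscr E_\omega$; the equalities and intersections in the claim are between closed subspaces of $\mathscr E_{\omega_j}$, respectively $\mathscr E_\omega$. A closed submodule $\mathscr L$ of $\mathscr E$ is orthogonally complemented if $\mathscr E=\mathscr L\oplus\mathscr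 L^\perp$, where $\mathscr L^\perp=\{x\in\mathscr E:\langle x,l\rangle=0\text{ for all }l\in\mathscr L\}$. For a subset $S$ of a topological vector space, the $\sigma$-convex hull of $S$ is $$\sigma\text{-}\mathrm{co}(S)=\Big\{\sum_{j=1}^\infty\lambda_js_j:\ s_j\in S,\ \lambda_j>0,\ \sum_{j=1}^\infty\lambda_j=1\Big\}$$ (convergent series); for sets of functionals on $\mathscr A$ the topology is the weak$^*$-topology, i.e. the series converge pointwise on $\mathscr A$ to a bounded functional. *)

(* Defs.v *)
From HB Require Import structures.
From mathcomp Require Import all_boot all_order all_algebra.
From mathcomp Require Import all_classical all_reals all_analysis.
From mathcomp Require Import sesquilinear complex.

Set Implicit Arguments.
Unset Strict Implicit.
Unset Printing Implicit Defensive.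

Import Order.TTheory GRing.Theory Num.Theory.
Import numFieldNormedType.Exports.

Local Open Scope classical_set_scope.
Local Open Scope ring_scope.
Local Open Scope complex_scope.

Reserved Notation "x ** y" (at level 40, left associativity).

(* The algebra is not assumed to be unital, so the multiplication is not an
   instance of the ring structures of the library. *)
HB.mixin Record CompleteNormedModule_isCStarAlgebra (R : realType) A
    & CompleteNormedModule R[i] A := {
  cmul : A -> A -> A;
  star : A -> A;
  cmulA : associative cmul;
  cmulDl : left_distributive cmul +%R;
  cmulDr : right_distributive cmul +%R;
  cmulZl : forall (c : R[i]) (a b : A), cmul (c *: a) b = c *: cmul a b;
  cmulZr : forall (c : R[i]) (a b : A), cmul a (c *: b) = c *: cmul a b;
  starK : involutive star;
  starD : {morph star : a b / a + b};
  starZ : forall (c : R[i]) (a : A), star (c *: a) = c^* *: star a;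
  starM : forall a b : A, star (cmul a b) = cmul (star b) (star a);
  ler_norm_cmul : forall a b : A, `|cmul a b| <= `|a| * `|b|;
  cstar_identity : forall a : A, `|cmul (star a) a| = `|a| ^+ 2
}.

#[short(type="cstarAlgType")]
HB.structure Definition CStarAlgebra (R : realType) :=
  {A of CompleteNormedModule_isCStarAlgebra R A & CompleteNormedModule R[i] A}.

Notation "x ** y" := (cmul x y) : ring_scope.

Definition cpositive (R : realType) (A : cstarAlgType R) : set A :=
  [set a | exists b : A, a = star b ** b].

(* Right modules, with an inner product linear in the second variable. *)
HB.mixin Record CompleteNormedModule_isHilbertModule (R : realType)
    (A : cstarAlgType R) E & CompleteNormedModule R[i] E := {
  ract : E -> A -> E;
  minner : E -> E -> A;
  ractDl : forall (x y : E) (a : A), ract (x + y) a = ract x a + ract y a;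
  ractDr : forall (x : E) (a b : A), ract x (a + b) = ract x a + ract x b;
  ractM : forall (x : E) (a b : A), ract x (a ** b) = ract (ract x a) b;
  ractZl : forall (c : R[i]) (x : E) (a : A),
    ract (c *: x) a = c *: ract x a;
  ractZr : forall (c : R[i]) (x : E) (a : A),
    ract x (c *: a) = c *: ract x a;
  minnerDr : forall x y z : E, minner x (y + z) = minner x y + minner x z;
  minnerZr : forall (c : R[i]) (x y : E), minner x (c *: y) = c *: minner x y;
  minner_ract : forall (x y : E) (a : A), minner x (ract y a) = minner x y ** a;
  star_minner : forall x y : E, star (minner x y) = minner y x;
  minner_pos : forall x : E, cpositive (minner x x);
  minner_eq0 : forall x : E, minner x x = 0 -> x = 0;
  norm_minner : forall x : E, `|x| ^+ 2 = `|minner x x| :> R[i]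
}.

#[short(type="hilbertModType")]
HB.structure Definition HilbertModule (R : realType) (A : cstarAlgType R) :=
  {E of CompleteNormedModule_isHilbertModule R A E
      & CompleteNormedModule R[i] E}.

Section hilbert_module_theory.
Context (R : realType) (A : cstarAlgType R) (E : hilbertModType A).

Definition closed_submodule (L : set E) : Prop :=
  [/\ closed L, L 0,
      forall x y, L x -> L y -> L (x + y),
      forall (c : R[i]) x, L x -> L (c *: x) &
      forall x (a : A), L x -> L (ract x a)].

Definition morth (L : set E) : set E :=
  [set x | forall l, L l -> minner x l = 0].

Definition orthogonally_complemented (L : set E) : Prop :=
  [set l + m | l in L & m in morth L] = [set: E] /\
  L `&` morth L = [set 0].

Definition positive_functional (w : {scalar A}) : Prop :=
  forall a : A, cpositive a -> 0 <= w a.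

Definition bounded_functional (w : {scalar A}) : Prop :=
  exists M : R, forall a : A, `|w a| <= M%:C * `|a|.

(* The sum is taken in the weak-* topology. *)
Definition sigma_co (S : set {scalar A}) : set {scalar A} :=
  [set w | bounded_functional w /\
     exists (lambda : R^nat) (s : nat -> {scalar A}),
       [/\ forall j, S (s j), forall j, 0 < lambda j,
           series lambda @ \oo --> (1 : R) &
           forall a : A, series (fun j => (lambda j)%:C * s j a) @ \oo
                           --> (w a : R[i]^o)]].

Definition null_space (w : {scalar A}) : set E :=
  [set x | w (minner x x) = 0].

End hilbert_module_theory.

(* The forms {dot V for _} of the library are linear in the first variable. *)
HB.mixin Record CompleteNormedModule_isHilbertSpace (R : realType) V
    & CompleteNormedModule R[i] V := {
  hdot : {dot V for @Num.conj R[i]};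
  norm_hdot : forall u : V, `|u| ^+ 2 = hdot u u
}.

#[short(type="hilbertSpaceType")]
HB.structure Definition HilbertSpace (R : realType) :=
  {V of CompleteNormedModule_isHilbertSpace R V & CompleteNormedModule R[i] V}.

(* A Hilbert space completion of the quotient of E by null_space w, given by
   the composite loc_map of the quotient map and the embedding of the quotient
   into its completion; loc_map_eq0 and loc_map_eq below show that loc_map
   identifies exactly the points of E that agree modulo null_space w. The
   arguments of hdot are swapped because minner is linear in the second
   variable. *)
Record localization (R : realType) (A : cstarAlgType R)
    (E : hilbertModType A) (w : {scalar A}) := Localization {
  loc_space : hilbertSpaceType R;
  loc_map : {linear E -> loc_space};
  loc_map_hdot : forall x y : E,
    hdot (loc_map y) (loc_map x) = w (minner x y);
  loc_map_dense : closure (range loc_map) = [set: loc_space]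
}.

Definition loc_sub (R : realType) (A : cstarAlgType R) (E : hilbertModType A)
    (w : {scalar A}) (Ew : localization E w) (L : set E) :
    set (loc_space Ew) :=
  closure (loc_map Ew @` L).
Arguments loc_sub {R A E w} Ew L.

Section localization_quotient.
Context (R : realType) (A : cstarAlgType R) (E : hilbertModType A).
Context (w : {scalar A}) (Ew : localization E w).

Lemma loc_map_eq0 (x : E) : loc_map Ew x = 0 <-> null_space w x.
Proof.
rewrite /null_space /= -(loc_map_hdot Ew) -norm_hdot; split=> [->|].
  by rewrite normr0 expr0n.
by move=> /eqP; rewrite expf_eq0 normr_eq0 => /eqP.
Qed.

Lemma loc_map_eq (x y : E) :
  loc_map Ew x = loc_map Ew y <-> null_space w (x - y).
Proof.
rewrite -loc_map_eq0 linearB; split=> [->|/eqP]; first by rewrite subrr.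
by rewrite subr_eq0 => /eqP.
Qed.

End localization_quotient.

(* Main.v *)
(* Write L for the intersection of H and K, and split each x in E as l x + m x
   with l x in L and m x orthogonal to L; this splitting is orthogonal for
   every form w <x, y>.  If w = sum_j lambda_j v_j then
   |x|_w^2 = sum_j lambda_j |x|_(v_j)^2, so each E_(v_j) seminorm is dominated
   by that of E_w.  Hence when x tends in E_w to a point xi of H_w and K_w, it
   also tends in each E_(v_j) to a point of H_(v_j) and K_(v_j), that is of
   L_(v_j), and so m x tends to 0 there.  As m x is moreover Cauchy for the
   seminorm of w, Fatou's argument gives that m x tends to 0 in E_w, so that
   l x tends to xi. *)

Require Import Defs.
From HB Require Import structures.
From mathcomp Require Import all_boot all_order all_algebra.
From mathcomp Require Import all_classical all_reals all_analysis.
From mathcomp Require Import sesquilinear complex.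

Set Implicit Arguments.
Unset Strict Implicit.
Unset Printing Implicit Defensive.

Import Order.TTheory GRing.Theory Num.Theory.
Import numFieldNormedType.Exports.

Local Open Scope classical_set_scope.
Local Open Scope ring_scope.
Local Open Scope complex_scope.

(* The library has this for a realFieldType; here C is R[i]. *)
Lemma real_cvgr_to_le (C : numFieldType) (T : Type) (F : set_system T)
    (FF : ProperFilter F) (f : T -> C) (a b : C) :
    a \is Num.real -> b \is Num.real ->
  f x @[x --> F] --> a -> (\forall x \near F, f x <= b) -> a <= b.
Proof.
move=> ar br fa fb; rewrite real_leNgt //; apply/negP => ba.
have ab0 : 0 < a - b by rewrite subr_gt0.
have [x [fxb /= afx]] :=
  filter_ex (filterI fb (cvgr_dist_lt f a fa (a - b) ab0)).
have fxr : f x \is Num.real by rewrite (ler_real fxb).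
have := le_lt_trans (real_ler_norm (rpredB ar fxr)) afx.
by rewrite ltrD2l ltrN2 real_ltNge// fxb.
Qed.

Lemma real_cvgr_to_ge (C : numFieldType) (T : Type) (F : set_system T)
    (FF : ProperFilter F) (f : T -> C) (a b : C) :
    a \is Num.real -> b \is Num.real ->
  f x @[x --> F] --> a -> (\forall x \near F, b <= f x) -> b <= a.
Proof.
move=> ar br fa fb; rewrite -lerN2; apply: (@real_cvgr_to_le _ _ F _ (\- f)).
- by rewrite rpredN.
- by rewrite rpredN.
- exact: cvgN.
- by apply: filterS fb => x; rewrite lerN2.
Qed.

Section localization_theory.
Context (R : realType) (A : cstarAlgType R) (E : hilbertModType A).

Lemma loc_norm (w : {scalar A}) (Ew : localization E w) (x : E) :
  `|loc_map Ew x| ^+ 2 = w (minner x x).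
Proof. by rewrite norm_hdot loc_map_hdot. Qed.

(** Pythagoras: the images of [l] and [m] are orthogonal in [Ew], because [w] vanishes at
    [minner m l = 0]. *)
Lemma loc_norm_morth (w : {scalar A}) (Ew : localization E w) (L : set E)
    (l m : E) : L l -> morth L m -> `|loc_map Ew m| <= `|loc_map Ew (l + m)|.
Proof.
move=> Ll Lm; rewrite -ler_sqr ?nnegrE ?normr_ge0// !norm_hdot linearD.
rewrite hnormDd; last first.
  by apply: etrans (loc_map_hdot Ew m l) _; rewrite (Lm _ Ll) linear0.
by rewrite lerDr dnorm_ge0.
Qed.

(* x near loc_filter xi means: the image of x in E_w is near xi. *)
Definition loc_filter (w : {scalar A}) (Ew : localization E w)
    (xi : loc_space Ew) : set_system E :=
  filter_from (nbhs xi) (fun B => loc_map Ew @^-1` B).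

(** Properness is the density of the image of [E] in the localization. *)
Global Instance loc_filter_proper (w : {scalar A}) (Ew : localization E w)
    (xi : loc_space Ew) : ProperFilter (loc_filter xi).
Proof.
apply: filter_from_proper.
  apply: filter_from_filter; first by exists setT; exact: filterT.
  by move=> B C xiB xiC; exists (B `&` C) => //; exact: filterI.
move=> B xiB; have : closure (range (loc_map Ew)) xi by rewrite loc_map_dense.
by move=> /(_ _ xiB) [_ [[x _ <-] Bx]]; exists x.
Qed.

Lemma near_loc_filter (w : {scalar A}) (Ew : localization E w)
    (xi : loc_space Ew) (e : R[i]) : 0 < e ->
  loc_filter xi [set x : E | `|xi - loc_map Ew x| < e].
Proof.
move=> e0; exists (ball xi e); first exact: nbhsx_ballx.
by move=> x; rewrite -ball_normE.
Qed.

(** The Cauchy property of the filter, nested so that [x] can be fixed before [y] varies. *)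
Lemma loc_filter_dist (w : {scalar A}) (Ew : localization E w)
    (xi : loc_space Ew) (e : R[i]) : 0 < e ->
  loc_filter xi [set x : E | loc_filter xi [set y : E |
    `|loc_map Ew (x - y)| < e]].
Proof.
move=> e0.
have e20 : 0 < e / 2 by rewrite divr_gt0.
have near_xi := near_loc_filter xi e20.
apply: filterS (near_xi) => x /= xix; apply: filterS near_xi => y /= xiy.
rewrite linearB (splitr e) (le_lt_trans (ler_distD xi _ _))//.
by rewrite ltrD// distrC.
Qed.

Section domination.
Context (w w' : {scalar A}) (Ew : localization E w) (Ew' : localization E w').
Context (C : R[i]) (C0 : 0 < C).
Hypothesis dom : forall x, `|loc_map Ew' x| <= C * `|loc_map Ew x|.

(** By [dom] the filter stays Cauchy in the complete space of [Ew']. Its limit plays the role of the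
    value at [xi] of the continuous extension of [loc_map Ew x] to [loc_map Ew' x]. *)
Lemma is_cvg_loc_map (xi : loc_space Ew) :
  cvg (loc_map Ew' x @[x --> loc_filter xi]).
Proof.
apply/cauchy_cvgP; apply: cauchy_exP => e e0.
have eC0 : 0 < e / C by rewrite divr_gt0.
have [x xF] := filter_ex (loc_filter_dist xi eC0).
exists (loc_map Ew' x); apply: filterS xF => y xy.
rewrite -ball_normE /ball_/= -linearB (le_lt_trans (dom _))//.
by rewrite mulrC -ltr_pdivlMr.
Qed.

Lemma loc_sub_lim (L : set E) (xi : loc_space Ew) (xi' : loc_space Ew') :
    loc_map Ew' x @[x --> loc_filter xi] --> xi' ->
  loc_sub Ew L xi -> loc_sub Ew' L xi'.
Proof.
move=> cvg_xi' Lxi B xi'B.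
have [D xiD sDB] := cvg_xi' _ xi'B.
have [_ [[x Lx <-] Dx]] := Lxi _ xiD.
by exists (loc_map Ew' x); split; [exists x|exact: sDB].
Qed.

End domination.

(** Approximate [xi] by the image of some [k] in [L]. Since [x - k = (l x - k) + m x] with [l x - k]
    in [L], the seminorm of [m x] is at most that of [x - k], which is small. *)
Lemma morth_cvg0 (w : {scalar A}) (Ew : localization E w) (L : set E)
    (l m : E -> E) (T : set_system E) (TF : Filter T) (xi : loc_space Ew) :
    (forall x y, L x -> L y -> L (x - y)) ->
    (forall x, L (l x)) -> (forall x, morth L (m x)) ->
    (forall x, l x + m x = x) ->
    loc_map Ew x @[x --> T] --> xi -> loc_sub Ew L xi ->
  loc_map Ew (m x) @[x --> T] --> (0 : loc_space Ew).
Proof.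
move=> LB Ll Lm lmE Txi Lxi; apply/cvgr0Pnorm_lt => e e0.
have e20 : 0 < e / 2 by rewrite divr_gt0.
have [_ [[k Lk <-] xik]] := Lxi _ (nbhsx_ballx xi _ e20).
move: xik; rewrite -ball_normE /ball_/= => xik.
apply: filterS (cvgr_dist_lt _ _ Txi _ e20) => x /= xix.
have := loc_norm_morth Ew (LB _ _ (Ll x) Lk) (Lm x).
move=> /le_lt_trans; apply.
rewrite addrAC lmE linearB (splitr e) (le_lt_trans (ler_distD xi _ _))//.
by rewrite ltrD// distrC.
Qed.

Lemma star0 : star (0 : A) = 0.
Proof. by apply: (addrI (star 0)); rewrite -starD !addr0. Qed.

Lemma morthB (L : set E) (x y : E) : morth L x -> morth L y -> morth L (x - y).
Proof.
move=> Lx Ly l Ll; have minner0 z : morth L z -> minner l z = 0.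
  by move=> Lz; rewrite -star_minner Lz// star0.
rewrite -star_minner -scaleN1r minnerDr minnerZr !minner0//.
by rewrite scaler0 addr0 star0.
Qed.

Section countable_sum.
Context (w : {scalar A}) (Ew : localization E w).
Context (lambda : R^nat) (v : nat -> {scalar A}).
Context (Ev : forall j, localization E (v j)).
Hypothesis lambda_gt0 : forall j, 0 < lambda j.
Hypothesis wE : forall a, series (fun j => (lambda j)%:C * v j a) @ \oo
  --> (w a : R[i]^o).

Let norm_series (x : E) : R[i]^nat :=
  series (fun j => (lambda j)%:C * `|loc_map (Ev j) x| ^+ 2).

Let real_sqr_norm (V : normedZmodType R[i]) (x : V) : `|x| ^+ 2 \is Num.real.
Proof. by rewrite rpredX// normr_real. Qed.

Let norm_term_ge0 (j : nat) (x : E) :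
  0 <= (lambda j)%:C * `|loc_map (Ev j) x| ^+ 2.
Proof. by rewrite mulr_ge0 ?exprn_ge0// lecR ltW. Qed.

Let norm_series_real (x : E) (J : nat) : norm_series x J \is Num.real.
Proof. by rewrite ger0_real// sumr_ge0. Qed.

Lemma cvg_norm_series (x : E) :
  norm_series x @ \oo --> (`|loc_map Ew x| ^+ 2 : R[i]^o).
Proof.
rewrite loc_norm; suff -> : norm_series x =
  series (fun j => (lambda j)%:C * v j (minner x x)) by exact: wE.
by congr series; apply/funext => j; rewrite loc_norm.
Qed.

Lemma norm_series_le (x : E) (J : nat) :
  norm_series x J <= `|loc_map Ew x| ^+ 2.
Proof.
apply: (real_cvgr_to_ge _ _ _ (@cvg_norm_series x)) => //.
exists J => // n /= Jn; rewrite /norm_series !seriesEnat /=.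
by rewrite [leRHS](@big_cat_nat _ _ _ J)//= lerDl sumr_ge0.
Qed.

Lemma loc_map_dominated (j : nat) : exists2 C : R[i], 0 < C &
  forall x, `|loc_map (Ev j) x| <= C * `|loc_map Ew x|.
Proof.
have l0 : 0 < (lambda j)%:C by rewrite ltcR.
(* The constant comes from bounding the single term of index [j] by the whole sum; [j.+1] below is
   the first partial sum containing it. *)
exists (sqrtC (lambda j)%:C^-1) => [|x]; first by rewrite sqrtC_gt0 invr_gt0.
rewrite -ler_sqr ?nnegrE ?mulr_ge0 ?sqrtC_ge0 ?invr_ge0 ?(ltW l0)//.
rewrite exprMn sqrtCK ler_pdivlMl//.
apply: le_trans (norm_series_le x j.+1); rewrite /norm_series seriesEnat /=.
by rewrite big_nat_recr//= lerDr sumr_ge0.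
Qed.

(** Fix [x]. A partial sum for [m x] is the limit in [y] of the one for [m x - m y], which is at
    most [e ^+ 2]. Only finite sums are passed to the limit in [y], so no uniformity in [j] is
    required; [J] then tends to infinity. *)
Lemma loc_map_cvg0 (F : set_system E) (FF : ProperFilter F) (m : E -> E) :
    (forall e : R[i], 0 < e ->
      F [set x | F [set y | `|loc_map Ew (m x - m y)| < e]]) ->
    (forall j, loc_map (Ev j) (m x) @[x --> F] --> (0 : loc_space (Ev j))) ->
  loc_map Ew (m x) @[x --> F] --> (0 : loc_space Ew).
Proof.
move=> Fm m0; apply/cvgr0Pnorm_le => e e0; apply: filterS (Fm e e0) => x xF.
rewrite -ler_sqr ?nnegrE ?normr_ge0 ?(ltW e0)//.
apply: (real_cvgr_to_le _ _ _ (@cvg_norm_series (m x))) => //.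
  by rewrite rpredX// gtr0_real.
apply: nearW => J.
have cvg_partial : norm_series (m x - m y) J @[y --> F] -->
    (norm_series (m x) J : R[i]^o).
  rewrite /norm_series seriesEnat /=.
  apply: (@cvg_big R[i]^o _ +%R) => [|j _]; first exact: add_continuous.
  have cvg_diff : loc_map (Ev j) (m x - m y) @[y --> F] -->
      loc_map (Ev j) (m x).
    apply/cvgrPdist_lt => d d0.
    apply: filterS (cvgr0_norm_lt _ (m0 j) _ d0) => y /=.
    by rewrite -linearB subKr.
  by apply: cvgM; [exact: cvg_cst|apply: cvgM; exact: cvg_norm].
apply: (real_cvgr_to_le _ _ _ cvg_partial) => //.
  by rewrite rpredX// gtr0_real.
apply: filterS xF => y xy; apply: le_trans (norm_series_le _ _) _.
by rewrite ler_sqr ?nnegrE ?normr_ge0 ?(ltW e0)// ltW.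
Qed.

End countable_sum.

End localization_theory.

Theorem corollary2p6 (R : realType) (A : cstarAlgType R)
    (E : hilbertModType A) (H K : set E)
    (hH : closed_submodule H) (hK : closed_submodule K)
    (hHK : orthogonally_complemented (H `&` K))
    (omega : nat -> {scalar A})
    (omega_pos : forall j, positive_functional (omega j))
    (E_omega : forall j, localization E (omega j))
    (hloc : forall j, loc_sub (E_omega j) (H `&` K) =
                      loc_sub (E_omega j) H `&` loc_sub (E_omega j) K)
    (w : {scalar A}) (hw : sigma_co (range omega) w)
    (E_w : localization E w) :
  loc_sub E_w (H `&` K) = loc_sub E_w H `&` loc_sub E_w K.
Proof.
set L := H `&` K in hHK *.
have LB x y : L x -> L y -> L (x - y).
  case: hH hK => _ _ HD HZ _ [_ _ KD KZ _] [Hx Kx] [Hy Ky].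
  by rewrite -scaleN1r; split; [apply/HD/HZ|apply/KD/KZ].
have /choice [lm lmP] x :
    exists p : E * E, [/\ L p.1, morth L p.2 & p.1 + p.2 = x].
  have : [set: E] x by [].
  by rewrite -hHK.1 => -[l Ll [m Lm lmx]]; exists (l, m).
pose l x := (lm x).1; pose m x := (lm x).2.
have Ll x : L (l x) by have [] := lmP x.
have Lm x : morth L (m x) by have [] := lmP x.
have lmE x : l x + m x = x by have [] := lmP x.
apply/seteqP; split=> [xi Lxi|xi [Hxi Kxi]].
  by split; apply: closureS Lxi; apply: image_subset => x [].
case: hw => _ [lambda [s [s_omega lambda_gt0 _ wE]]].
(* Reindexing the series by [i] makes the given localizations [E_omega] and the hypothesis [hloc]
   available for its terms. *)
have /choice [i iE] j : exists k, omega k = s j.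
  by have [k _ ks] := s_omega j; exists k.
have {}iE : s = omega \o i by apply/funext => j; rewrite -iE.
subst s; pose Ev j := E_omega (i j).
have m_cvg0 j : loc_map (Ev j) (m x) @[x --> loc_filter xi] -->
    (0 : loc_space (Ev j)).
  have [C C0 dom] := loc_map_dominated E_w Ev lambda_gt0 wE j.
  have xij := is_cvg_loc_map C0 dom (xi := xi).
  apply: (morth_cvg0 _ LB Ll Lm lmE xij).
  (* The limit in [Ev j] inherits membership from [xi] for [H] and [K] separately; [hloc] merges the
     two. *)
  by rewrite /L hloc; split; apply: loc_sub_lim xij _.
have mw_cvg0 : loc_map E_w (m x) @[x --> loc_filter xi] -->
    (0 : loc_space E_w).
  apply: (loc_map_cvg0 lambda_gt0 wE _ _ m_cvg0) => e e0.
  apply: filterS (loc_filter_dist xi e0) => x; apply: filterS => y /=.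
  apply: le_lt_trans.
  (* Linearity of [l] and [m] is avoided: [x - y] is the sum of [l x - l y] in [L] and [m x - m y]
     in [morth L]. *)
  have := loc_norm_morth E_w (LB _ _ (Ll x) (Ll y)) (morthB (Lm x) (Lm y)).
  by rewrite addrACA -opprD !lmE.
have lw_cvg : loc_map E_w (l x) @[x --> loc_filter xi] --> xi.
  apply/cvgrPdist_lt => e e0; have e20 : 0 < e / 2 by rewrite divr_gt0.
  have near_m0 : loc_filter xi [set x : E | `|loc_map E_w (m x)| < e / 2].
    exact: cvgr0_norm_lt mw_cvg0 _ e20.
  apply: filterS2 (near_loc_filter xi e20) near_m0 => x /= xix mx.
  (* In [E_w], [xi - l x] is [(xi - x) + m x]. *)
  rewrite -[l x](addrK (m x)) lmE linearB opprD opprK addrA (splitr e).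
  by rewrite (le_lt_trans (ler_normD _ _))// ltrD.
move=> B xiB; have : loc_filter xi [set x | B (loc_map E_w (l x))].
  exact: lw_cvg xiB.
move=> /filter_ex [x Bx]; exists (loc_map E_w (l x)).
by split=> //; exists (l x).
Qed.
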